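(* The relative growth series $\sum_{x\in B_F}s^{|x|}$ of $B_F=\bigoplus_{\mathbb{Z}}F$ in $L_F$ is the rational function $(1+rs)P(s)^{2}$, where $P(s)=1+\frac{rs^3}{1-s^2(1+rs)}$, and $$\lim_{n\to\infty}\#\big(B(n)\cap B_F\big)^{1/n}=\rho_r<\omega_r .$$ Thus $B_F$ is a normal subgroup of $L_F$ with amenable quotient $\mathbb{Z}$, hence co-amenable, yet it has growth deficiency $\log\omega_r-\log\rho_r>0$ relative to the growth rate $\omega_r=\lim_n \#B(n)^{1/n}$ of $L_F$. As $r\to\infty$, $\omega_r\sim\sqrt r$ and $\rho_r\sim r^{1/3}$, so the deficiency satisfies $\log\omega_r-\log\rho_r\sim\frac16\log r$ and is unbounded over the family.
   Context: Let $F$ be a finite group with identity $e$ and $|F|=r+1\ge2$. Let $L_F=F\wr\mathbb{Z}$ be the group of pairs $x=(\eta,j)$ with $\eta:\mathbb{Z}\to F$ finitely supported and $j\in\mathbb{Z}$, with multiplication $(\eta,j)(\eta',j')=(\eta\cdot\tau_j\eta',\,j+j')$, where $\tau_j\eta'(i)=\eta'(i-j)$ and the product of configurations is pointwise in $F$. The standard generating set is $S=\{t^{\pm1}\}\cup(F\setminus\{e\})$, where $t=(\mathbf{e},1)$ with $\mathbf e$ the trivial configuration, and $c\in F\setminus\{e\}$ is identified with $(\delta^c,0)$, $\delta^c$ being equal to $c$ at $0$ and trivial elsewhere. Let $|x|$ be the word length in $L_F$ with respect to $S$ and $B(n)=\{x\in L_F:|x|\le n\}$. The base group $B_F=\bigoplus_{\mathbb{Z}}F$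 is the kernel of the cursor homomorphism $\pi(\eta,j)=j$. Let $\rho_r>1$ be the unique real number $>1$ with $\rho_r^3=\rho_r+r$, and $\omega_r=\frac{1+\sqrt{1+4r}}2$ (so $\omega_r^2=\omega_r+r$). *)

(* Defs.v *)
From HB Require Import structures.
From mathcomp Require Import all_boot all_order all_algebra fingroup finmap.
From mathcomp Require Import all_classical all_reals all_analysis.
From mathcomp Require Import ring lra.

Set Implicit Arguments.
Unset Strict Implicit.
Unset Printing Implicit Defensive.

Import Order.TTheory GRing.Theory Num.Theory.
Import numFieldNormedType.Exports.

Local Open Scope classical_set_scope.
Local Open Scope ring_scope.

Section WordMetric.
Local Open Scope group_scope.
Variables (G : groupType) (S : set G).

(* Words use letters of S only, not their inverses: S is meant to be
   symmetric. *)
Definition is_word (n : nat) (x : G) : Prop :=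
  exists w : seq G,
    [/\ size w = n, forall s, s \in w -> S s & x = \prod_(s <- w) s].

Definition generates : Prop := forall x : G, exists n, is_word n x.

(* The default value 0 is used only for elements that are not products of
   letters of S. *)
Definition word_length (x : G) : nat :=
  xget 0%N [set n | is_word n x /\ forall m, is_word m x -> (n <= m)%N].

Definition ball (n : nat) : set G := [set x | (word_length x <= n)%N].

Definition ball_count (A : set G) (n : nat) : nat :=
  #|` fset_set (ball n `&` A)|.

Definition sphere_count (A : set G) (n : nat) : nat :=
  #|` fset_set ([set x | word_length x = n] `&` A)|.

Lemma word_lengthP : generates -> forall x,
  is_word (word_length x) x /\ forall m, is_word m x -> (word_length x <= m)%N.
Proof.
move=> genS x; rewrite /word_length.
have [n nP] := genS x.
case: xgetP => [m -> //|noP].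
have exP : exists n, `[< is_word n x >] by exists n; apply/asboolP.
exfalso; apply: (noP (ex_minn exP)); case: ex_minnP => k /asboolP kP kmin.
by split=> // m mP; apply/kmin/asboolP.
Qed.

Lemma ball_finite : generates -> finite_set S -> forall n, finite_set (ball n).
Proof.
move=> genS finS n.
have fin_word k : finite_set [set x | is_word k x].
  elim: k => [|k IHk].
    apply: (sub_finite_set _ (finite_set1 1)) => x [w [/size0nil -> _ ->]].
    by rewrite big_nil.
  have /sub_finite_set := finite_image2 (fun a b : G => a * b) finS IHk.
  apply=> x [[|a w] /= [szw wS ->]] //; rewrite big_cons.
  exists a; first by apply: wS; rewrite mem_head.
  exists (\prod_(s <- w) s) => //; exists w; split=> // [|s sw]; first by case: szw.
  by apply: wS; rewrite inE sw orbT.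
have fin_le : finite_set (\bigcup_(k in `I_n.+1) [set x | is_word k x]).
  by apply: bigcup_finite => // k _; exact: fin_word.
apply: sub_finite_set fin_le => x xn; exists (word_length x) => //.
by case: (word_lengthP genS x).
Qed.

End WordMetric.

Section Growth.
Variables (R : realType) (G : groupType) (S : set G).

Definition growth_seq (A : set G) : nat -> R :=
  fun n => (ball_count S A n)%:R `^ (n%:R^-1).

Definition growth_rate (A : set G) : R := lim (growth_seq A @ \oo).

Definition growth_deficiency (A : set G) : R :=
  ln (growth_rate setT) - ln (growth_rate A).

End Growth.

(* The formal power series with coefficients a is the expansion at 0 of the
   rational function f; this does not depend on the representation p / q. *)
Definition series_expansion (K : fieldType) (a : nat -> K)
    (f : {fraction {poly K}}) : Prop :=
  exists p q : {poly K},
    [/\ q`_0 != 0, f = tofrac p / tofrac q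
      & forall n, \sum_(i < n.+1) q`_i * a (n - i)%N = p`_n].

Section Cosets.
Local Open Scope group_scope.
Variable G : groupType.
Implicit Types (H : set G) (g x y : G).

Definition normal_subgroup H : Prop :=
  [/\ H 1, forall x y, H x -> H y -> H (x * y^-1) & forall x g, H x -> H (x ^ g)].

Definition left_coset H x : set G := [set x * h | h in H].

Definition cosets H : Type := {A : set G | exists x, A = left_coset H x}.

Definition coset_proj H x : cosets H :=
  exist _ (left_coset H x) (ex_intro _ x erefl).

Lemma translate_subproof H g (A : cosets H) :
  exists x, [set g * a | a in sval A] = left_coset H x.
Proof.
case: A => _ /= [x ->]; exists (g * x); apply/seteqP; split=> y /=.
  by case=> _ [h hH <-] <-; exists h => //; rewrite mulgA.
by case=> h hH <-; exists (x * h); [exists h|rewrite mulgA].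
Qed.

Definition translate H g (A : cosets H) : cosets H :=
  exist _ [set g * a | a in sval A] (translate_subproof g A).

(* The law of the quotient group G / H is xH . yH = (xy)H. *)
Definition quotient_isog H (Q : groupType) : Prop :=
  exists phi : cosets H -> Q, bijective phi /\
    forall x y, phi (coset_proj H (x * y)) =
                phi (coset_proj H x) * phi (coset_proj H y).

End Cosets.

(* An invariant mean on the bounded functions on X, where G acts through act;
   the values of m at unbounded functions are irrelevant. *)
Definition invariant_mean (R : realType) (G X : Type) (act : G -> X -> X)
    (m : (X -> R) -> R) : Prop :=
  [/\ forall (a : R) (f g : X -> R), bounded_fun f -> bounded_fun g ->
        m (fun x => a * f x + g x) = a * m f + m g,
      forall f : X -> R, bounded_fun f -> (forall x, 0 <= f x) -> 0 <= m f,
      m (fun=> 1) = 1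
    & forall (g : G) (f : X -> R), bounded_fun f -> m (f \o act g) = m f].

Definition amenable (R : realType) (G : groupType) : Prop :=
  exists m : (G -> R) -> R, invariant_mean (fun g x : G => (g * x)%g) m.

Definition coamenable (R : realType) (G : groupType) (H : set G) : Prop :=
  exists m : (cosets H -> R) -> R, invariant_mean (@translate G H) m.

Section Lamplighter.
Local Open Scope group_scope.
Local Open Scope fset_scope.
Variable F : groupType.

Definition config : choiceType := {fsfun int -> F with 1}.

Implicit Types (eta xi : config) (i j : int).

Definition cfg_one : config := [fsfun].

Definition cfg_shift j eta : config :=
  [fsfun i in [fset (k + j)%R | k in finsupp eta] => eta (i - j)%R | 1].

Definition cfg_mul eta xi : config :=
  [fsfun i in finsupp eta `|` finsupp xi => eta i * xi i | 1].

Definition cfg_inv eta : config := [fsfun i in finsupp eta => (eta i)^-1 | 1].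

Lemma cfg_oneE i : cfg_one i = 1.
Proof. by rewrite fsfun_dflt // finsupp0. Qed.

Lemma cfg_shiftE j eta i : cfg_shift j eta i = eta (i - j)%R.
Proof.
rewrite /cfg_shift fsfunE; case: ifPn => // iN.
rewrite fsfun_dflt //; apply: contra iN => iS.
by apply/imfsetP; exists (i - j)%R => //=; rewrite subrK.
Qed.

Lemma cfg_mulE eta xi i : cfg_mul eta xi i = eta i * xi i.
Proof.
rewrite /cfg_mul fsfunE; case: ifPn => //.
rewrite in_fsetU negb_or => /andP[iN jN].
by rewrite !fsfun_dflt // mulg1.
Qed.

Lemma cfg_invE eta i : cfg_inv eta i = (eta i)^-1.
Proof.
by rewrite /cfg_inv fsfunE; case: ifPn => // iN; rewrite fsfun_dflt // invg1.
Qed.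

(* The group F wr Z; a pair is (configuration, cursor position). *)
Definition lamplighter : Type := (config * int)%type.

HB.instance Definition _ := Choice.on lamplighter.

Implicit Types x y z : lamplighter.

Definition ll_one : lamplighter := (cfg_one, 0%R).

Definition ll_mul x y : lamplighter :=
  (cfg_mul x.1 (cfg_shift x.2 y.1), (x.2 + y.2)%R).

Definition ll_inv x : lamplighter :=
  (cfg_shift (- x.2)%R (cfg_inv x.1), (- x.2)%R).

Definition cfgE := (cfg_mulE, cfg_shiftE, cfg_invE, cfg_oneE).

Lemma ll_mulA : associative ll_mul.
Proof.
move=> x y z; congr pair; last exact: addrA.
by apply/fsfunP => i; rewrite /= !cfgE mulgA opprD addrA.
Qed.

Lemma ll_mul1 : left_id ll_one ll_mul.
Proof.
move=> [eta j]; congr pair; last exact: add0r.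
by apply/fsfunP => i; rewrite /= !cfgE mul1g subr0.
Qed.

Lemma ll_mulr1 : right_id ll_one ll_mul.
Proof.
move=> [eta j]; congr pair; last exact: addr0.
by apply/fsfunP => i; rewrite /= !cfgE mulg1.
Qed.

Lemma ll_mulV : left_inverse ll_one ll_inv ll_mul.
Proof.
move=> [eta j]; congr pair; last exact: addNr.
by apply/fsfunP => i; rewrite /= !cfgE mulVg.
Qed.

Lemma ll_mulrV : right_inverse ll_one ll_inv ll_mul.
Proof.
move=> [eta j]; congr pair; last exact: addrN.
by apply/fsfunP => i; rewrite /= !cfgE opprK subrK mulgV.
Qed.

HB.instance Definition _ :=
  isGroup.Build lamplighter ll_mulA ll_mul1 ll_mulr1 ll_mulV ll_mulrV.

Definition cursor (x : lamplighter) : int := x.2.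

Lemma cursorM x y : cursor (x * y) = (cursor x + cursor y)%R.
Proof. by []. Qed.

Definition base_group : set lamplighter := [set x | cursor x = 0%R].

Definition cursor_shift : lamplighter := (cfg_one, 1%R).

Definition lamp (c : F) : lamplighter := ([fsfun i in [fset 0%R] => c | 1], 0%R).

Definition std_gens : set lamplighter :=
  [set x | [\/ x = cursor_shift, x = cursor_shift^-1
             | exists2 c : F, c != 1 & x = lamp c]].

Lemma std_gens_generates : generates std_gens.
Proof.
pose gen (x : lamplighter) := exists n, is_word std_gens n x.
have gen1 : gen 1 by exists 0%N, [::]; rewrite big_nil; split.
have genM x y : gen x -> gen y -> gen (x * y).
  move=> [n [v [_ vS ->]]] [m [w [_ wS ->]]].
  exists (size (v ++ w)), (v ++ w); split=> //; last by rewrite big_cat.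
  by move=> s; rewrite mem_cat => /orP[/vS|/wS].
have genS x : std_gens x -> gen x.
  move=> Sx; exists 1%N, [:: x]; rewrite big_seq1; split=> // s.
  by rewrite inE => /eqP ->.
have cursorE j : gen ((cfg_one, j) : lamplighter).
  have pairD i k : ((cfg_one, (i + k)%R) : lamplighter) =
      ((cfg_one, i) : lamplighter) * ((cfg_one, k) : lamplighter).
    congr pair; apply/fsfunP => l.
    by rewrite /= !cfgE mulg1.
  have invE : cursor_shift^-1 = ((cfg_one, (- 1)%R) : lamplighter).
    congr pair; apply/fsfunP => l.
    by rewrite /= !cfgE invg1.
  elim: j => [|n IHn|n IHn]; first exact: gen1.
    rewrite -addn1 PoszD pairD; apply: (genM) => //.
    by apply: genS; constructor 1.
  rewrite -addn1 PoszD opprD pairD; apply: (genM) => //.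
  by rewrite -invE; apply: genS; constructor 2.
pose single i (c : F) : config := [fsfun k in [fset i] => c | 1].
have singleE i c k : single i c k = if k == i then c else 1.
  by rewrite /single fsfunE inE.
have genX i c : gen ((single i c, 0%R) : lamplighter).
  have -> : ((single i c, 0%R) : lamplighter) =
     ((cfg_one, i) : lamplighter) * lamp c * ((cfg_one, (- i)%R) : lamplighter).
    congr pair; last by rewrite /= addr0 subrr.
    apply/fsfunP => k.
    rewrite /= !cfgE mulg1 mul1g singleE fsfunE inE.
    by rewrite subr_eq0.
  apply: (genM) => //; apply: (genM) => //.
  have [->|c1] := eqVneq c 1; last by apply: genS; constructor 3; exists c.
  suff -> : lamp 1 = 1 by [].
  by congr pair; apply/fsfunP => k; rewrite fsfunE cfgE; case: ifP.
have genC (s : seq int) (eta : config) :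
    {subset finsupp eta <= s} -> gen ((eta, 0%R) : lamplighter).
  elim: s eta => [|i s IHs] eta sub.
    have -> : eta = cfg_one by apply/fsfunP => k; rewrite cfgE fsfun_dflt //;
      apply/negP => /sub.
    exact: cursorE.
  pose eta' : config := [fsfun k in finsupp eta => if k == i then 1 else eta k | 1].
  have eta'E k : eta' k = if k == i then 1 else eta k.
    rewrite /eta' fsfunE; case: ifPn => // kN.
    by rewrite (fsfun_dflt kN); case: ifP.
  have -> : ((eta, 0%R) : lamplighter) =
      ((eta', 0%R) : lamplighter) * ((single i (eta i), 0%R) : lamplighter).
    congr pair; apply/fsfunP => k.
    rewrite /= !cfgE subr0 eta'E singleE.
    by case: eqP => [->|_]; rewrite ?mul1g ?mulg1.
  apply: (genM) => //; apply: IHs => k.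
  rewrite mem_finsupp eta'E; have [_|ki] := eqVneq k i; first by rewrite eqxx.
  by rewrite -mem_finsupp => /sub; rewrite inE (negPf ki).
move=> [eta j].
have -> : ((eta, j) : lamplighter) =
    ((eta, 0%R) : lamplighter) * ((cfg_one, j) : lamplighter).
  congr pair; last by rewrite /= add0r.
  by apply/fsfunP => k; rewrite /= !cfgE mulg1.
by apply: (genM) => //; apply: (genC (finsupp eta)).
Qed.

End Lamplighter.

Lemma std_gens_finite (F : finGroupType) : finite_set (@std_gens F).
Proof.
have fin : finite_set ([set cursor_shift F; (cursor_shift F)^-1%g]
    `|` [set lamp c | c in [set: F]]).
  by rewrite !finite_setU; split; [split; exact: finite_set1|exact: finite_image].
apply: sub_finite_set fin => x [->|->|[c _ ->]]; last by right; exists c.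
- by left; left.
- by left; right.
Qed.

(* rho r is meant for r >= 1 only, see rhoP. *)
Definition rho (R : realType) (r : nat) : R :=
  xget 0 [set x : R | 1 < x /\ x ^+ 3 = x + r%:R].

Lemma rhoP (R : realType) (r : nat) : (0 < r)%N ->
  [/\ 1 < rho R r, rho R r ^+ 3 = rho R r + r%:R
    & forall x : R, 1 < x -> x ^+ 3 = x + r%:R -> x = rho R r].
Proof.
move=> r0; have r1 : 1 <= r%:R :> R by rewrite ler1n.
have [x1 x3] : 1 < rho R r /\ rho R r ^+ 3 = rho R r + r%:R.
  apply: (@xgetPex _ 0 [set x : R | 1 < x /\ x ^+ 3 = x + r%:R]).
  pose p : {poly R} := 'X^3 - 'X - r%:R%:P.
  have pE x : p.[x] = x ^+ 3 - x - r%:R by rewrite /p !hornerE.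
  have [||x /andP[x1 _] /rootP] := @poly_ivt R p 1 (1 + r%:R).
  - by rewrite lerDl ler0n.
  - by rewrite !pE; apply/andP; split; nra.
  rewrite pE => px; exists x; split; last by lra.
  rewrite lt_neqAle x1 andbT; apply/eqP => x_1.
  by move: px; rewrite -x_1 expr1n; lra.
split=> // x hx hx3; apply/eqP; rewrite -subr_eq0.
have /eqP : (x - rho R r) * (x ^+ 2 + x * rho R r + rho R r ^+ 2 - 1) = 0.
  by move: hx3 x3; lra.
rewrite mulf_eq0 => /orP[//|/eqP]; nra.
Qed.

Definition omega (R : realType) (r : nat) : R :=
  (1 + Num.sqrt (1 + 4 * r%:R)) / 2.

Definition relgrowth_P (r : nat) : {fraction {poly rat}} :=
  1 + tofrac (r%:R *: 'X^3) / tofrac (1 - 'X^2 * (1 + r%:R *: 'X)).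

(* Main.v *)
(* An element (eta, j) is spelled by walking the cursor along Z and switching
   lamps, so its length is #|supp eta| plus the length of the shortest walk from
   0 to j through supp eta; if the walk stays in [-a, b], that is 2(a + b) - |j|.
   For j = 0 the two sides of the origin are independent, and a side is a
   sequence over F with nontrivial last entry, each site of which costs 2, plus
   1 if its lamp is lit; this gives (1 + rs) P(s)^2.
   For the growth rates, count sequences w over F with k |w| + #lit(w) <= m by
   removing the first entry: the count grows like theta^m with
   theta^(k+1) = theta + r. Up to polynomial factors, k = 2 counts balls in the
   base group and k = 1 balls in the whole group: moving on from a site for good
   costs 1, coming back costs 2.
   Co-amenability transports an invariant mean of Z, the limit of Cesaro means
   along a free ultrafilter. *)

Require Import Defs.
From mathcomp Require Import all_boot all_order all_algebra fingroup finmap.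
From mathcomp Require Import all_classical all_reals all_analysis.
From mathcomp Require Import zify ring lra.

Import Order.TTheory GRing.Theory Num.Theory.
Import numFieldNormedType.Exports.
Local Open Scope classical_set_scope.
Local Open Scope ring_scope.

Set Implicit Arguments.
Unset Strict Implicit.
Unset Printing Implicit Defensive.

(** * Word length *)

Section WordLength.
Variable F : groupType.
Implicit Types (eta : config F) (x y : lamplighter F) (i j : int).

Local Notation S := (@std_gens F).

Definition covers (a b : nat) eta j : Prop :=
  (forall i, eta i != 1%g -> - a%:Z <= i <= b%:Z) /\ - a%:Z <= j <= b%:Z.

(** The bound [#supp + 2(a + b) - |j| <= n] on the length of a walk through the window [-a, b], with
    [|j|] moved to the right to avoid truncated subtraction. *)
Definition reachable n eta j : Prop := exists a b : nat,
  covers a b eta j /\ (#|` finsupp eta| + 2 * (a + b) <= n + `|j|)%N.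

Lemma std_gens_lamp c : c != 1%g -> S (lamp c).
Proof. by move=> c1; constructor 3; exists c. Qed.

Lemma is_word0 : is_word S 0 1%g.
Proof. by exists [::]; rewrite big_nil. Qed.

Lemma is_wordS n x s : is_word S n x -> S s -> is_word S n.+1 (x * s)%g.
Proof.
move=> [w [sw wS ->]] Ss; exists (rcons w s); rewrite size_rcons sw -cats1 big_cat big_seq1.
by split=> // u; rewrite mem_cat orbC mem_seq1 => /orP[/eqP->|/wS].
Qed.

(** Words are peeled from the right because right multiplication by a letter acts locally: it moves
    the cursor by one or changes the lamp under it. *)
Lemma is_word_ind (P : nat -> lamplighter F -> Prop) :
  P 0%N 1%g -> (forall n x s, P n x -> S s -> P n.+1 (x * s)%g) ->
  forall n x, is_word S n x -> P n x.
Proof.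
move=> P0 PS n x [w [<- wS ->]]; elim/last_ind: w wS => [|w s IHw] wS.
  by rewrite big_nil.
rewrite -cats1 big_cat big_seq1 size_cat addn1; apply: PS.
  by apply: IHw => u uw; apply: wS; rewrite mem_rcons inE uw orbT.
by apply: wS; rewrite mem_rcons mem_head.
Qed.

Lemma mul_shiftE x : (x * cursor_shift F)%g = (x.1, x.2 + 1).
Proof. by congr pair; apply/fsfunP => i; rewrite !cfgE mulg1. Qed.

Lemma mul_shiftVE x : (x * (cursor_shift F)^-1)%g = (x.1, x.2 - 1).
Proof. by congr pair; apply/fsfunP => i; rewrite !cfgE invg1 mulg1. Qed.

Lemma mul_lampE x c : (x * lamp c)%g =
  ([fsfun x.1 with x.2 |-> (x.1 x.2 * c)%g], x.2).
Proof.
congr pair; last by rewrite /= addr0.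
apply/fsfunP => i; rewrite !cfgE fsfun_withE /= fsfunE inE subr_eq0.
by case: eqP => [->|_]; rewrite ?mulg1.
Qed.

(** Inside the window [|j|] drops by at most one, which the extra letter pays for. A step out of the
    window costs 2 more, paid by the extra letter and by the growth of [|j|]. *)
Lemma reachable_shift n eta j (e : int) : e = 1 \/ e = -1 ->
  reachable n eta j -> reachable n.+1 eta (j + e).
Proof.
move=> eE [a [b [[sup jab] le_n]]].
have [/andP[h1 h2]|hb] := boolP (- a%:Z <= j + e <= b%:Z).
  by exists a, b; split; [split=> //; lia|lia].
have [jb|ja] : j + e = b.+1%:Z \/ j + e = - a.+1%:Z by lia.
  by exists a, b.+1; split; [split=> [i /sup|]; lia|lia].
by exists a.+1, b; split; [split=> [i /sup|]; lia|lia].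
Qed.

Lemma reachable_lamp n eta j c : reachable n eta j ->
  reachable n.+1 [fsfun eta with j |-> c] j.
Proof.
move=> [a [b [[sup jab] le_n]]]; exists a, b; split.
  split=> // i; rewrite fsfun_withE; case: (i =P j) => [-> //|_]; exact: sup.
suff : (#|` finsupp [fsfun eta with j |-> c]| <= #|` finsupp eta|.+1)%N by lia.
rewrite finsupp_with; case: ifP => _.
  exact/leqW/fsubset_leq_card/fsubD1set.
by rewrite cardfsU1; case: (_ \notin _); lia.
Qed.

Lemma is_word_reachable n x : is_word S n x -> reachable n x.1 x.2.
Proof.
elim/is_word_ind => {n x} [|n x s IHx [->|->|[c c1 ->]]].
- exists 0%N, 0%N; split; last by rewrite /= finsupp0 cardfs0.
  by split=> // i; rewrite /= cfg_oneE eqxx.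
- by rewrite mul_shiftE; apply: reachable_shift => //; left.
- by rewrite mul_shiftVE; apply: reachable_shift => //; right.
- by rewrite mul_lampE; apply: reachable_lamp.
Qed.

Lemma is_word_move n eta j (e : int) m : e = 1 \/ e = -1 ->
  is_word S n (eta, j) -> is_word S (n + m) (eta, j + e * m%:Z).
Proof.
move=> eE wn; elim: m => [|m IHm]; first by rewrite mulr0 addr0 addn0.
rewrite addnS.
case: eE IHm => -> IHm.
  have /= := is_wordS IHm (Or31 _ _ erefl); rewrite mul_shiftE /=.
  by congr is_word; congr pair; lia.
have /= := is_wordS IHm (Or32 _ _ erefl); rewrite mul_shiftVE /=.
by congr is_word; congr pair; lia.
Qed.

(** A one-way walk can light every lamp it passes, so a sweep costs one letter per move and one per
    lit lamp. The induction takes off the last site. *)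
Lemma is_word_sweep n l (e : int) m eta : e = 1 \/ e = -1 ->
  is_word S n (cfg_one F, l) ->
  (forall i, eta i != 1%g -> exists2 k, (k <= m)%N & i = l + e * k%:Z) ->
  is_word S (n + m + #|` finsupp eta|) (eta, l + e * m%:Z).
Proof.
move=> eE w0; elim: m eta => [|m IHm] eta sup.
  have etaE : eta = [fsfun cfg_one F with l |-> eta l].
    apply/fsfunP => i; rewrite fsfun_withE; case: eqP => [-> //|il].
    rewrite cfg_oneE; apply/eqP; apply: contraT => /sup [k]; lia.
  rewrite mulr0 addr0 addn0.
  have [e1|e1] := eqVneq (eta l) 1%g.
    have eta1 : eta = cfg_one F.
      by rewrite etaE e1; apply/fsfunP => i; rewrite fsfun_withE cfg_oneE if_same.
    by rewrite eta1 finsupp0 cardfs0 addn0.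
  have := is_wordS w0 (std_gens_lamp e1).
  rewrite mul_lampE /= cfg_oneE mul1g -etaE; congr is_word.
  have := finsupp_with (cfg_one F) l (eta l).
  by rewrite -etaE (negPf e1) => ->; rewrite finsupp0 cardfsU1 cardfs0 in_fset0 addn0 addn1.
set p := l + e * m.+1%:Z.
(* Darkening the end point [p] leaves a configuration that the sweep of length [m] can produce. *)
pose eta' : config F := [fsfun eta with p |-> 1%g].
have /IHm w' : forall i, eta' i != 1%g -> exists2 k, (k <= m)%N & i = l + e * k%:Z.
  move=> i; rewrite fsfun_withE; case: (i =P p); rewrite ?eqxx // => ip /sup [k km ik].
  exists k => //; move: km; rewrite leq_eqVlt => /orP[/eqP kE|//].
  by case: ip; rewrite ik kE.
have {}w' : is_word S (n + m + #|` finsupp eta'| + 1) (eta', p).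
  have := is_word_move 1 eE w'; congr is_word; congr pair.
  by rewrite /p -addrA -mulrDr; congr (_ + _ * _); lia.
have etaE : eta = [fsfun eta' with p |-> eta p].
  apply/fsfunP => i; rewrite fsfun_withE; case: eqP => [-> //|/eqP ip].
  by rewrite fsfun_withE (negPf ip).
have [e1|e1] := eqVneq (eta p) 1%g.
  suff eE' : eta = eta' by move: w'; rewrite -eE'; congr is_word; rewrite addn1 addnS addSn.
  by apply/fsfunP => i; rewrite fsfun_withE; case: eqP => [->|].
have := is_wordS w' (std_gens_lamp e1).
rewrite mul_lampE /= fsfun_withE eqxx mul1g -etaE; congr is_word.
have cE := cardfsD1 p (finsupp eta); rewrite mem_finsupp e1 add1n in cE.
by rewrite finsupp_with eqxx cE !addnS !addSn addn0.
Qed.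

(** The sign of [j] decides which end is visited first: the last leg comes from the end on the side
    of [j] and so is shorter by [|j|]. *)
Lemma covers_is_word a b eta j : covers a b eta j ->
  exists2 n, is_word S n (eta, j) & (n + `|j| = #|` finsupp eta| + 2 * (a + b))%N.
Proof.
move=> [sup jab]; have [j0|j0] := lerP 0 j.
  (* Walk 0 -> -a -> b -> j, lighting the lamps on the second leg. *)
  have left_end i : - a%:Z <= i <= b%:Z ->
      exists2 k, (k <= a + b)%N & i = 0 + -1 * a%:Z + 1 * k%:Z.
    by exists `|(i + a%:Z)%R|%N; lia.
  have w1 := is_word_move a (or_intror (erefl (-1 : int))) is_word0.
  have w2 := is_word_sweep (m := a + b) (eta := eta) (or_introl erefl) w1.
  have {}w2 := w2 (fun i si => left_end i (sup i si)).
  have w3 := is_word_move `|b%:Z - j| (or_intror (erefl (-1 : int))) w2.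
  exists (0 + a + (a + b) + #|` finsupp eta| + `|(b%:Z - j)%R|)%N; last by lia.
  by move: w3; congr is_word; congr pair; lia.
(* The mirror walk 0 -> b -> -a -> j. *)
have right_end i : - a%:Z <= i <= b%:Z ->
    exists2 k, (k <= a + b)%N & i = 0 + 1 * b%:Z + -1 * k%:Z.
  by exists `|(b%:Z - i)%R|%N; lia.
have w1 := is_word_move b (or_introl (erefl (1 : int))) is_word0.
have w2 := is_word_sweep (m := a + b) (eta := eta) (or_intror erefl) w1.
have {}w2 := w2 (fun i si => right_end i (sup i si)).
have w3 := is_word_move `|a%:Z + j| (or_introl (erefl (1 : int))) w2.
exists (0 + b + (a + b) + #|` finsupp eta| + `|(a%:Z + j)%R|)%N; last by lia.
by move: w3; congr is_word; congr pair; lia.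
Qed.

Lemma word_length_leP n eta j :
  (word_length S (eta, j) <= n)%N <-> reachable n eta j.
Proof.
have [wx xmin] := word_lengthP (@std_gens_generates F) (eta, j).
split=> [le_n|[a [b [/covers_is_word [m /xmin mx mE] le_n]]]]; last by lia.
have [a [b [cx le_x]]] := is_word_reachable wx.
by exists a, b; split=> //; apply: leq_trans le_x _; rewrite leq_add2r.
Qed.

End WordLength.

Lemma leq_card_fset_set (T : choiceType) (X : set T) (s : seq T) :
  finite_set X -> uniq s -> (forall x, x \in s -> X x) ->
  (size s <= #|` fset_set X|)%N.
Proof.
move=> finX us sX; apply: uniq_leq_size => // x /sX Xx.
by rewrite in_fset_set // mem_set.
Qed.

Lemma card_fset_set_leq (T : choiceType) (X : set T) (s : seq T) :
  finite_set X -> (forall x, X x -> x \in s) -> (#|` fset_set X| <= size s)%N.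
Proof.
move=> finX Xs; apply: uniq_leq_size => [|x]; first exact: fset_uniq.
by rewrite in_fset_set // => /set_mem /Xs.
Qed.

(** * Encoding configurations by words over F *)

Section Configurations.
Variable F : groupType.
Implicit Types (u v w : seq F) (eta : config F).

Definition lit w : nat := count (fun c => c != 1%g) w.

Definition lamp_at u v (i : int) : F :=
  match i with Posz k => nth 1%g v k | Negz k => nth 1%g u k end.

(* v lists the lamps at 0, 1, 2, and so on; u those at -1, -2, and so on. *)
Definition cfg_of u v : config F :=
  [fsfun i in seq_fset tt (map Negz (iota 0 (size u)) ++ map Posz (iota 0 (size v)))
     => lamp_at u v i | 1%g].

Lemma cfg_ofE u v i : cfg_of u v i = lamp_at u v i.
Proof.
rewrite /cfg_of fsfunE seq_fsetE mem_cat; case: ifPn => //.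
rewrite negb_or; case: i => k /andP[] => [_|+ _]; rewrite mem_map ?mem_iota /= -?leqNgt.
- by move=> ?; rewrite nth_default.
- by move=> ? ? [].
- by move=> ?; rewrite nth_default.
- by move=> ? ? [].
Qed.

Lemma lit_iota w : lit w = count (fun k => nth 1%g w k != 1%g) (iota 0 (size w)).
Proof. by rewrite /lit -{1}(mkseq_nth 1%g w) count_map. Qed.

Lemma card_finsupp_cfg_of u v : #|` finsupp (cfg_of u v)| = (lit u + lit v)%N.
Proof.
pose pos w := [seq k <- iota 0 (size w) | nth 1%g w k != 1%g].
have pos_size w : size (pos w) = lit w by rewrite size_filter lit_iota.
have mem_pos w k : (k \in pos w) = (nth 1%g w k != 1%g).
  rewrite mem_filter mem_iota /= add0n; case: ltnP => [_|kw]; first by rewrite andbT.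
  by rewrite nth_default ?eqxx.
rewrite -!pos_size -(size_map Negz) -(size_map Posz (pos v)) -size_cat.
apply: perm_size; apply: uniq_perm; first exact: fset_uniq.
  rewrite cat_uniq !map_inj_uniq ?filter_uniq ?iota_uniq //=; try by move=> ? ? [].
  by rewrite andbT; apply/hasPn => _ /mapP[k _ ->]; apply/mapP => -[].
move=> i; rewrite mem_finsupp cfg_ofE mem_cat; case: i => k /=.
  rewrite mem_map ?mem_pos; last by move=> ? ? [].
  by rewrite orbC; case: (_ != _) => //=; apply/esym/mapP => -[].
rewrite mem_map ?mem_pos; last by move=> ? ? [].
by case: (_ != _) => //=; apply/esym/mapP => -[].
Qed.

(** Sizes must agree because trailing trivial entries leave no trace in the configuration. *)
Lemma cfg_of_inj u v u' v' : size u = size u' -> size v = size v' ->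
  cfg_of u v = cfg_of u' v' -> u = u' /\ v = v'.
Proof.
move=> su sv cE; split; apply: (@eq_from_nth _ 1%g) => // k _.
  by have := congr1 (fun f : config F => f (Negz k)) cE; rewrite !cfg_ofE.
by have := congr1 (fun f : config F => f (Posz k)) cE; rewrite !cfg_ofE.
Qed.

Lemma card_finsupp_shift j eta : #|` finsupp (cfg_shift j eta)| = #|` finsupp eta|.
Proof.
have -> : finsupp (cfg_shift j eta) = [fset (k + j)%R | k in finsupp eta]%fset.
  apply/fsetP => i; rewrite mem_finsupp cfg_shiftE; apply/idP/imfsetP => /=.
    by move=> h; exists (i - j); rewrite ?subrK // mem_finsupp.
  by move=> [k + ->]; rewrite mem_finsupp addrK.
by rewrite card_imfset //; apply: addIr.
Qed.

(** The window [0, b], with nothing to the left of the origin, is what the lower bounds on balls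
    use. *)
Lemma reachable_right n w (b j : nat) : (size w <= b.+1)%N -> (j <= b)%N ->
  (lit w + 2 * b <= n + j)%N -> reachable n (cfg_of [::] w) j.
Proof.
move=> wb jb le_n; exists 0%N, b; split; last by rewrite card_finsupp_cfg_of.
split; last by lia.
move=> i; rewrite cfg_ofE; case: i => k; rewrite /lamp_at; last by rewrite nth_nil eqxx.
have [/leq_trans/(_ wb) kb _|kw] := ltnP k (size w); first by lia.
by rewrite nth_default ?eqxx.
Qed.

(** For the upper bounds: an element is determined by the left end of its window, its cursor and the
    word of length [a + b + 1] read there. That extra 1 produces the summand 2; [a <= n] and
    [|j| <= n] hold since [|j| <= a + b]. *)
Lemma reachable_window n eta (j : int) : reachable n eta j ->
  exists a w, [/\ eta = cfg_shift (- a%:Z) (cfg_of [::] w), (a <= n)%N,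
    (`|j| <= n)%N, (`|j| < size w)%N & (lit w + 2 * size w <= n + 2 + `|j|)%N].
Proof.
move=> [a [b [[sup jab] le_n]]].
pose w := [seq eta (k%:Z - a%:Z) | k <- iota 0 (a + b).+1].
have sw : size w = (a + b).+1 by rewrite size_map size_iota.
have etaE : eta = cfg_shift (- a%:Z) (cfg_of [::] w).
  apply/fsfunP => i; rewrite cfg_shiftE cfg_ofE opprK.
  have [/andP[i1 i2]|iN] := boolP (- a%:Z <= i <= b%:Z).
    have [k kE] : exists k : nat, i + a%:Z = k by exists `|(i + a%:Z)%R|%N; lia.
    rewrite kE /= (nth_map 0%N) ?size_iota ?nth_iota; try lia.
    by rewrite add0n -kE addrK.
  have -> : eta i = 1%g by apply/eqP; apply: contraNT iN => /sup.
  case E : (i + a%:Z) => [k|k] /=; last by rewrite nth_nil.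
  by rewrite nth_default // sw; lia.
exists a, w; split=> //; rewrite ?sw; try lia.
suff -> : lit w = #|` finsupp eta| by lia.
by rewrite etaE card_finsupp_shift card_finsupp_cfg_of.
Qed.

End Configurations.

(** * Growth rates *)

Section LightWords.
Variables (R : realType) (F : finGroupType) (r k : nat) (theta : R).
Hypotheses (cardF : #|F| = r.+1) (k0 : (0 < k)%N).
Hypotheses (theta1 : 1 <= theta) (thetaE : theta ^+ k.+1 = theta + r%:R).

Lemma size_enum_neq1 : size [seq c <- enum F | c != 1%g] = r.
Proof.
have := count_predC (pred1 (1%g : F)) (enum F).
rewrite count_uniq_mem ?enum_uniq // mem_enum -cardE cardF add1n => -[<-].
by rewrite size_filter.
Qed.

(** The count satisfies N(m) = 1 + N(m-k) + r N(m-k-1), while [theta ^+ m] satisfies the same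
    recursion without the 1. The factor [theta ^+ k] absorbs the initial values m < k, and the
    factor [m.+1] absorbs the summands 1. *)
Lemma light_words m : exists s : seq (seq F),
  [/\ uniq s, forall w, (w \in s) = (k * size w + lit w <= m)%N,
    theta ^+ m <= theta ^+ k * (size s)%:R
  & (size s)%:R <= m.+1%:R * theta ^+ m].
Proof.
have th_gt0 : 0 < theta := lt_le_trans ltr01 theta1.
have thX (i : nat) : 1 <= theta ^+ i by rewrite exprn_ege1.
have thetaD e : theta ^+ (e.+1 + k) = theta ^+ e.+1 + r%:R * theta ^+ e.
  by rewrite addSnnS exprD thetaE exprS mulrDr mulrC [X in _ + X]mulrC.
elim/ltn_ind: m => m IHm; have [mk|km] := ltnP m k.
  exists [:: [::]]; split=> // [[|c w]||].
  - by rewrite mem_head muln0.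
  - by rewrite inE /= mulnS; apply/esym/negbTE; rewrite -ltnNge; lia.
  - by rewrite /= mulr1; apply: ler_weXn2l => //; lia.
  by rewrite mulr_ege1 // ler1n.
have [d dE] : exists d, m = (d + k)%N by exists (m - k)%N; lia.
have /IHm [s1 [us1 mem1 lo1 up1]] : (d < m)%N by lia.
(* A lit first entry leaves the budget d - 1. The strict inequality makes [s2] empty when d = 0. *)
have [s2 [us2 mem2 lo2 up2]] : exists s : seq (seq F),
    [/\ uniq s, forall w, (w \in s) = (k * size w + lit w < d)%N,
      (0 < d)%N -> theta ^+ d.-1 <= theta ^+ k * (size s)%:R
    & (size s)%:R <= d%:R * theta ^+ d.-1].
  case: d dE {lo1 up1 mem1}  => [|e] dE; first by exists [::]; rewrite mul0r.
  have /IHm [s [us mems los ups]] : (e < m)%N by lia.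
  by exists s; split.
pose s := [::] :: map (cons 1%g) s1 ++
  [seq c :: w | c <- [seq c <- enum F | c != 1%g], w <- s2].
have sE : (size s)%:R = 1 + (size s1)%:R + r%:R * (size s2)%:R :> R.
  by rewrite /= size_cat size_map size_allpairs size_enum_neq1 -nat1r natrD natrM addrA.
have mem_s c w : (c :: w \in s) = if c == 1%g then w \in s1 else w \in s2.
  rewrite inE mem_cat /=; case: eqVneq => [->|c1].
    rewrite mem_map; last by move=> ? ? [].
    case: (w \in s1) => //=; apply/allpairsP => -[[c' w'] [/=]].
    by rewrite mem_filter => /andP[c'1 _] _ [cE _]; rewrite -cE eqxx in c'1.
  have -> : (c :: w \in map (cons 1%g) s1) = false.
    by apply/mapP => -[w' _ [cE _]]; rewrite cE eqxx in c1.
  apply/allpairsP/idP => [[[c' w'] [/= _ ? [_ ->]]] //|ws2].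
  by exists (c, w); rewrite mem_filter c1 mem_enum.
exists s; split.
- rewrite /= cat_uniq; apply/and3P; split.
  + rewrite mem_cat negb_or; apply/andP; split; first by apply/mapP => -[].
    by apply/allpairsP => -[? []].
  + by rewrite map_inj_uniq // => ? ? [].
  apply/andP; split; last first.
    apply: allpairs_uniq => //; first exact/filter_uniq/enum_uniq.
    by move=> [? ?] [? ?] _ _ [-> ->].
  apply/hasPn => _ /allpairsP[[c w] [/= + _ ->]]; rewrite mem_filter => /andP[c1 _].
  by apply/mapP => -[w' _ [cE _]]; rewrite cE eqxx in c1.
- case=> [|c w]; first by rewrite mem_head /= muln0.
  by rewrite mem_s mem1 mem2 dE /= mulnS; case: (c == 1%g) => /=; apply/idP/idP; lia.
- rewrite sE dE; case: d dE lo1 lo2 {mem1 mem2 up1 up2} => [|e] _ lo1 lo2.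
    rewrite add0n; apply: ler_peMr; first exact/exprn_ge0/ltW.
    rewrite -addrA lerDl.
    by rewrite addr_ge0 ?mulr_ge0.
  have {}lo2 := ler_wpM2l (ler0n R r) (lo2 isT); rewrite /= in lo2.
  rewrite thetaD !mulrDr mulr1; apply: lerD; last by rewrite mulrCA.
  by rewrite -[leLHS]add0r lerD // ltW // exprn_gt0.
rewrite sE dE; case: d dE up1 up2 {mem1 mem2 lo1 lo2} => [|e] _ up1 up2.
  have -> : size s2 = 0%N.
    by apply/eqP; rewrite -leqn0 -(ler_nat R); rewrite mul0r in up2.
  rewrite expr0 mulr1 in up1; rewrite mulr0 addr0 add0n.
  apply: (@le_trans _ _ (k.+1%:R)); last by rewrite ler_peMr.
  by rewrite -natr1 addrC lerD // (le_trans up1) // ler_nat.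
have up2' := ler_wpM2l (ler0n R r) up2.
rewrite thetaD /=; set p := theta ^+ e.+1 in up1 *; set q := theta ^+ e in up2' *.
have p1 : 1 <= p := thX _; have q1 : 1 <= q := thX _.
(* As k >= 1, the new factor is at least e + 3 while [s1] needs only e + 2; the spare [p >= 1] pays
   for the empty word. *)
have hk : e.+1%:R + 2 <= (e.+1 + k).+1%:R :> R by rewrite -natrD ler_nat; lia.
have rq : 0 <= r%:R * q by rewrite mulr_ge0 //; lra.
apply: le_trans (ler_wpM2r _ hk); last by lra.
rewrite -natr1 in up1; move: (e.+1%:R : R) up1 up2' => E up1 up2'.
by rewrite /= in up2'; lra.
Qed.

End LightWords.

(** * Bounds on balls in the whole group and in the base group *)

Section BallCounts.
Variables (R : realType) (F : finGroupType) (r : nat) (theta : R).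
Hypotheses (cardF : #|F| = r.+1) (theta1 : 1 <= theta).

Local Notation S := (@std_gens F).
Local Notation B := (@base_group F).

Lemma std_ball_finite n (A : set (lamplighter F)) : finite_set (Defs.ball S n `&` A).
Proof.
apply: sub_finite_set (@subIsetl _ _ _) _.
exact: ball_finite (@std_gens_generates F) (@std_gens_finite F) n.
Qed.

Lemma ball_count_setT_ge n : theta ^+ 2 = theta + r%:R ->
  theta ^+ n <= theta * (ball_count S setT n)%:R.
Proof.
move=> thetaE; have [s [us mems lo _]] := light_words (k := 1) cardF isT theta1 thetaE n.
apply: le_trans lo _; rewrite expr1 ler_wpM2l ?(le_trans ler01) ?ler_nat //.
(* The cursor position [size w] saves the way back, and it records the length, so [w] is recovered
   despite trailing trivial entries. *)
pose f w : lamplighter F := (cfg_of [::] w, (size w)%:Z).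
rewrite -(size_map f); apply: leq_card_fset_set; first exact: std_ball_finite.
  rewrite map_inj_uniq // => u v [cE sE].
  by have [] := cfg_of_inj (erefl (size [::])) sE cE.
move=> _ /mapP[w ws ->]; split=> //; apply/word_length_leP.
apply: reachable_right (leqnSn _) (leqnn _) _; rewrite mems in ws.
have weight (x y : nat) : (1 * x + y <= n -> y + 2 * x <= n + x)%N by lia.
exact: weight ws.
Qed.

Lemma ball_count_base_ge n : (0 < r)%N -> theta ^+ 3 = theta + r%:R ->
  theta ^+ n <= theta ^+ 2 * (ball_count S B n.+1)%:R.
Proof.
move=> r0 thetaE; have [s [us mems lo _]] := light_words (k := 2) cardF isT theta1 thetaE n.
have [c c1] : exists c : F, c != 1%g.
  have : (0 < size [seq c <- enum F | c != 1%g])%N by rewrite (size_enum_neq1 cardF).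
  by rewrite size_filter -has_count => /hasP[c _ c1]; exists c.
apply: le_trans lo _; rewrite ler_wpM2l ?ler_nat ?exprn_ge0 ?(le_trans ler01) //.
(* The final lit lamp makes w recoverable from the configuration. *)
pose f w : lamplighter F := (cfg_of [::] (rcons w c), 0).
rewrite -(size_map f); apply: leq_card_fset_set; first exact: std_ball_finite.
  rewrite map_inj_uniq // => u v [cE].
  have nE k : nth 1%g (rcons u c) k = nth 1%g (rcons v c) k.
    by have := congr1 (fun f : config F => f (Posz k)) cE; rewrite !cfg_ofE.
  have [uv|uv|uv] := ltngtP (size u) (size v).
  - have := nE (size v); rewrite nth_default ?size_rcons // nth_rcons ltnn eqxx => cE'.
    by rewrite -cE' eqxx in c1.
  - have := nE (size u); rewrite nth_rcons ltnn eqxx nth_default ?size_rcons // => cE'.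
    by rewrite cE' eqxx in c1.
  apply: (@rcons_injl _ c); apply: (@eq_from_nth _ 1%g) => [|k _] //.
  by rewrite !size_rcons uv.
move=> _ /mapP[w ws ->]; split=> //; apply/word_length_leP.
(* The marker lamp sits at site [size w]: the round trip costs [2 * size w], and lighting the marker
   is the extra letter in [n.+1]. *)
apply: (reachable_right (b := size w)) => //; first by rewrite size_rcons.
rewrite mems in ws; rewrite /lit -cats1 count_cat /= c1 addn0.
have weight (x y : nat) : (2 * x + y <= n -> y + 1 + 2 * x <= n.+1 + 0)%N by lia.
exact: weight ws.
Qed.

Definition translated (a : nat) (j : int) (w : seq F) : lamplighter F :=
  (@cfg_shift F (- a%:Z) (@cfg_of F [::] w), j).

Definition window n (s : seq (seq F)) : seq (lamplighter F) :=
  [seq translated p.1 p.2 w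
  | p <- [seq (a, i%:Z - n%:Z) | a <- iota 0 n.+1, i <- iota 0 (n + n).+1], w <- s].

Lemma size_window n s : size (window n s) = (n.+1 * (n + n).+1 * size s)%N.
Proof. by rewrite !size_allpairs !size_iota. Qed.

Lemma mem_window n s (a : nat) (j : int) w : (a <= n)%N -> (`|j| <= n)%N -> w \in s ->
  translated a j w \in window n s.
Proof.
move=> an jn ws; apply/allpairsP; exists ((a, j), w); split=> //.
apply/allpairsP; exists (a, `|(j + n%:Z)%R|%N); rewrite !mem_iota /=; split; try lia.
by congr pair; lia.
Qed.

(** Listing all left ends and cursors overcounts by a quadratic factor only, which disappears in
    n-th roots. Membership in [A] enters through the cursor alone, so both the whole group and the
    base group are covered. *)
Lemma card_ball_window n s (A : set (lamplighter F)) :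
  (forall (w : seq F) (j : int), A (cfg_one F, j) -> (`|j| <= n)%N -> (`|j| < size w)%N ->
     (lit w + 2 * size w <= n + 2 + `|j|)%N -> w \in s) ->
  (forall x, A x -> A (cfg_one F, x.2)) ->
  (ball_count S A n <= n.+1 * (n + n).+1 * size s)%N.
Proof.
move=> ins Acur; rewrite -size_window; apply: card_fset_set_leq.
  exact: std_ball_finite.
move=> [eta j] [/word_length_leP/reachable_window [a [w [-> an jn jw le_w]]] Ax].
by apply: mem_window => //; apply: ins le_w => //; exact: (Acur _ Ax).
Qed.

Lemma ball_count_setT_le n : theta ^+ 2 = theta + r%:R ->
  (ball_count S setT n)%:R <= 2 * theta * n.+3%:R ^+ 3 * theta ^+ n.
Proof.
move=> thetaE; have [s [us mems _ up]] := light_words (k := 1) cardF isT theta1 thetaE n.+1.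
have : (ball_count S setT n <= n.+1 * (n + n).+1 * size s)%N.
  apply: card_ball_window => // w j _ jn jw le_w; rewrite mems.
  (* [|j| < size w] trades one of the two copies of [size w] for [|j|]: a walk that need not return
     pays once per site. *)
  have weight (x y : nat) : (`|j| < x -> y + 2 * x <= n + 2 + `|j| ->
    1 * x + y <= n.+1)%N by lia.
  exact: weight jw le_w.
rewrite -(ler_nat R) => /le_trans; apply; rewrite natrM.
have {}up : (size s)%:R <= n.+3%:R * theta ^+ n.+1.
  apply: le_trans up _; rewrite ler_wpM2r ?ler_nat //.
  exact/exprn_ge0/(le_trans ler01).
have polyn : (n.+1 * (n + n).+1 <= 2 * n.+3 ^ 2)%N by nia.
have {}polyn : (n.+1 * (n + n).+1)%:R <= 2 * n.+3%:R ^+ 2 :> R.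
  by rewrite -natrX -natrM ler_nat.
apply: le_trans (ler_pM _ _ polyn up) _ => //.
by rewrite [theta ^+ n.+1]exprS le_eqVlt; apply/orP; left; apply/eqP; ring.
Qed.

Lemma ball_count_base_le n : theta ^+ 3 = theta + r%:R ->
  (ball_count S B n)%:R <= 2 * theta ^+ 2 * n.+3%:R ^+ 3 * theta ^+ n.
Proof.
move=> thetaE; have [s [us mems _ up]] := light_words (k := 2) cardF isT theta1 thetaE n.+2.
have : (ball_count S B n <= n.+1 * (n + n).+1 * size s)%N.
  apply: card_ball_window => // w j j0 _ _; rewrite mems.
  have -> : j = 0 := j0.
  have weight (x y : nat) : (y + 2 * x <= n + 2 + 0 -> 2 * x + y <= n.+2)%N by lia.
  exact: weight.
rewrite -(ler_nat R) => /le_trans; apply; rewrite natrM.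
have polyn : (n.+1 * (n + n).+1 <= 2 * n.+3 ^ 2)%N by nia.
have {}polyn : (n.+1 * (n + n).+1)%:R <= 2 * n.+3%:R ^+ 2 :> R.
  by rewrite -natrX -natrM ler_nat.
apply: le_trans (ler_pM _ _ polyn up) _ => //.
have -> : theta ^+ n.+2 = theta ^+ 2 * theta ^+ n by rewrite -exprD.
by rewrite le_eqVlt; apply/orP; left; apply/eqP; ring.
Qed.

End BallCounts.

(** * From two-sided bounds to the limit of n-th roots *)

Section GrowthLimit.
Variable R : realType.

(** From ln x = 2 ln(sqrt x). It makes logarithms of polynomial factors negligible after division by
    n. *)
Lemma ln_le_sqrt (x : R) : 0 < x -> ln x <= 2 * Num.sqrt x.
Proof.
move=> x0; have s0 : 0 < Num.sqrt x by rewrite sqrtr_gt0.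
rewrite -{1}[x]sqr_sqrtr ?(ltW x0) // lnXn // -[leLHS]mulr_natl ler_pM2l //.
exact/ltW/ln_sublinear.
Qed.

(** On the logarithmic scale both bounds put [ln (u n)] within O(sqrt n) of [n * ln theta], and
    dividing by n leaves an error O(1 / sqrt n). *)
Lemma cvg_powR_inv (u : nat -> nat) (C theta : R) : 1 <= theta -> 0 < C ->
  (forall n, theta ^+ n <= C * (u n.+1)%:R) ->
  (forall n, (u n)%:R <= C * n.+3%:R ^+ 3 * theta ^+ n) ->
  (u n)%:R `^ n%:R^-1 @[n --> \oo] --> theta.
Proof.
move=> theta1 C0 lo up; have theta0 : 0 < theta := lt_le_trans ltr01 theta1.
have u0 n : 0 < (u n.+1)%:R :> R.
  by rewrite -(pmulr_rgt0 _ C0) (lt_le_trans _ (lo n)) // exprn_gt0.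
(* [|ln C|] comes from the constant, [ln theta] from the index shift in the lower bound, and 12 = 3
   * 4 from the cubic factor with ln(n + 3) <= 4 sqrt n. *)
pose M : R := `|ln C| + ln theta + 12.
have lnth0 : 0 <= ln theta by rewrite ln_ge0.
have M0 : 0 < M by rewrite /M; have := normr_ge0 (ln C); lra.
have bound n : (0 < n)%N -> `|n%:R * ln theta - ln (u n)%:R| <= M * Num.sqrt n%:R.
  case: n => // n _.
  have sn1 : 1 <= Num.sqrt n.+1%:R :> R by rewrite -{1}sqrtr1 ler_wsqrtr // ler1n.
  have lo' : n%:R * ln theta - ln C <= ln (u n.+1)%:R.
    have : ln (theta ^+ n) <= ln (C * (u n.+1)%:R).
      by rewrite ler_ln ?posrE ?exprn_gt0 ?mulr_gt0.
    by rewrite lnXn // lnM ?posrE // -[ln theta *+ n]mulr_natl; lra.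
  have up' : ln (u n.+1)%:R <= ln C + 3 * ln (n.+1).+3%:R + n.+1%:R * ln theta.
    have : ln (u n.+1)%:R <= ln (C * (n.+1).+3%:R ^+ 3 * theta ^+ n.+1).
      by rewrite ler_ln ?posrE ?mulr_gt0 ?exprn_gt0.
    rewrite !lnM ?posrE ?mulr_gt0 ?exprn_gt0 // !lnXn //.
    rewrite -[ln theta *+ _]mulr_natl; move: (ln n.+4%:R) (n.+1%:R * _) => y z; lra.
  have ln3 : ln (n.+1).+3%:R <= 4 * Num.sqrt n.+1%:R :> R.
    apply: le_trans (ln_le_sqrt _) _; first by rewrite ltr0n.
    have -> : 4 = 2 * 2 :> R by rewrite -natrM.
    rewrite -mulrA ler_pM2l //.
    have -> : 2 = Num.sqrt (2 ^+ 2) :> R by rewrite sqrtr_sqr ger0_norm.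
    by rewrite -sqrtrM // ler_wsqrtr // -natrX -natrM ler_nat; lia.
  have hC := ler_norm (ln C); have hC' := ler_norm (- ln C); rewrite normrN in hC'.
  have nth : n.+1%:R * ln theta = n%:R * ln theta + ln theta by rewrite -natr1; ring.
  rewrite ler_norml /M; move: (Num.sqrt _) sn1 ln3 => s sn1 ln3.
  have p1 : 0 <= `|ln C| * (s - 1) by rewrite mulr_ge0 ?subr_ge0.
  have p2 : 0 <= ln theta * (s - 1) by rewrite mulr_ge0 ?subr_ge0.
  move: nth up' ln3; move: (n.+1%:R * _) (ln n.+4%:R) => y z nth up' ln3.
  by apply/andP; split; lra.
have -> : theta = expR (ln theta) by rewrite lnK.
have cvgln : n%:R^-1 * ln (u n)%:R @[n --> \oo] --> ln theta.
  apply/cvgrPdist_le => e e0; near=> n.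
  have n0 : (0 < n)%N by near: n; exact: nbhs_infty_gt.
  have nR : 0 < n%:R :> R by rewrite ltr0n.
  have sn : Num.sqrt n%:R ^+ 2 = n%:R :> R by rewrite sqr_sqrtr.
  have -> : ln theta - n%:R^-1 * ln (u n)%:R = n%:R^-1 * (n%:R * ln theta - ln (u n)%:R).
    by field; rewrite gt_eqF.
  rewrite normrM ger0_norm ?invr_ge0 // ler_pdivrMl // (le_trans (bound _ n0)) //.
  have : M / e <= Num.sqrt n%:R.
    rewrite -[leLHS]ger0_norm ?divr_ge0 ?(ltW M0) ?(ltW e0) // -sqrtr_sqr ler_wsqrtr //.
    by near: n; exact: nbhs_infty_ger.
  rewrite ler_pdivrMr //; have : 0 < Num.sqrt n%:R :> R by rewrite sqrtr_gt0.
  move: sn; set s := Num.sqrt _ => sn s0 Ms.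
  have -> : n%:R * e = s * e * s by rewrite -sn; ring.
  by rewrite ler_pM2r.
have : expR (n%:R^-1 * ln (u n)%:R) @[n --> \oo] --> expR (ln theta).
  by apply: continuous_cvg => //; exact: continuous_expR.
apply: cvg_trans; apply: near_eq_cvg; near=> n.
have n0 : (0 < n)%N by near: n; exact: nbhs_infty_gt.
(* [powR] is the exponential of a logarithm only for a nonzero base; [u n] is positive for n > 0. *)
by rewrite /powR gt_eqF //; rewrite -(prednK n0).
Unshelve. all: end_near. Qed.

End GrowthLimit.

(** * The relative growth series *)

Section BaseLength.
Variable F : groupType.
Implicit Types (u v w : seq F).

(* 1 + the position of the last nontrivial entry, 0 if there is none. *)
Fixpoint extent w : nat :=
  if w is c :: w' then if lit w == 0%N then 0%N else (extent w').+1 else 0%N.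

Lemma extent_cons c w :
  extent (c :: w) = if lit (c :: w) == 0%N then 0%N else (extent w).+1.
Proof. by []. Qed.

(** The cost of a round trip from the origin along one side. *)
Definition weight w : nat := (lit w + 2 * extent w)%N.

Lemma lit_cons c w : lit (c :: w) = ((c != 1%g) + lit w)%N.
Proof. by []. Qed.

Lemma lit_neq0P w : reflect (exists k, nth 1%g w k != 1%g) (lit w != 0%N).
Proof.
rewrite -lt0n -has_count; apply: (iffP hasP) => [[c /(nthP 1%g)[k _ <-]]|[k wk]].
  by exists k.
exists (nth 1%g w k) => //; apply: mem_nth; rewrite ltnNge.
by apply: contra wk => ?; rewrite nth_default.
Qed.

Lemma extent_leP w b :
  (extent w <= b)%N <-> (forall k, nth 1%g w k != 1%g -> (k < b)%N).
Proof.
elim: w b => [|c w IHw] b; first by split=> // _ k; rewrite nth_nil eqxx.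
rewrite extent_cons; case: ifPn => [/eqP lit0|/lit_neq0P [k ck]].
  split=> // _ k ck; suff : lit (c :: w) != 0%N by rewrite lit0.
  by apply/lit_neq0P; exists k.
split=> [|sup]; first by case: b => // b /IHw sup [//|l] /sup.
case: b sup => [/(_ _ ck)//|b] sup.
by apply/IHw => l wl; have /= := sup l.+1 wl.
Qed.

(** With the cursor back at 0 the least window is [-extent u, extent v], its ends being chosen
    independently, so the length is additive. Here [x] is the lamp at 0 and [v] starts at site 1. *)
Lemma word_length_base u x v : word_length (@std_gens F) (cfg_of u (x :: v), 0)
  = ((x != 1%g) + weight u + weight v)%N.
Proof.
have h n : reachable n (cfg_of u (x :: v)) 0 <->
    ((x != 1%g) + weight u + weight v <= n)%N.
  rewrite /reachable card_finsupp_cfg_of /weight lit_cons.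
  split=> [[a [b [[sup _] le_n]]]|le_n].
    have /extent_leP ua : forall k, nth 1%g u k != 1%g -> (k < a)%N.
      by move=> k uk; have := sup (Negz k); rewrite cfg_ofE => /(_ uk); lia.
    have /extent_leP vb : forall k, nth 1%g v k != 1%g -> (k < b)%N.
      by move=> k vk; have := sup (Posz k.+1); rewrite cfg_ofE => /(_ vk); lia.
    by lia.
  exists (extent u), (extent v); split; last by lia.
  split; last by lia.
  move=> [[|k]|k]; rewrite cfg_ofE; first by lia.
    by have /extent_leP/(_ k) h := leqnn (extent v) => /h; lia.
  by have /extent_leP/(_ k) h := leqnn (extent u) => /h; lia.
apply/anti_leq/andP; split; first by apply/word_length_leP/h.
exact/h/word_length_leP.
Qed.

End BaseLength.

(** * Spheres of the base group and their generating function *)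

Section SphereSeries.
Variables (F : finGroupType) (r : nat).
Hypothesis cardF : #|F| = r.+1.

Local Notation S := (@std_gens F).
Local Notation B := (@base_group F).

Fixpoint all_seqs N : seq (seq F) :=
  if N is N'.+1 then [seq c :: w | c <- enum F, w <- all_seqs N'] else [:: [::]].

Lemma mem_all_seqs N w : (w \in all_seqs N) = (size w == N).
Proof.
elim: N w => [|N IHN] [|c w] //=; first by apply/allpairsP => -[[? ?] []].
rewrite eqSS -IHN; apply/allpairsP/idP => [[[c' w'] [_ /= ? [_ ->]]] //|wN].
by exists (c, w); rewrite mem_enum.
Qed.

Lemma all_seqs_uniq N : uniq (all_seqs N).
Proof.
elim: N => //= N IHN; apply: allpairs_uniq => //; first exact: enum_uniq.
by move=> [? ?] [? ?] _ _ [-> ->].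
Qed.

Definition side_poly N : {poly rat} := \sum_(w <- all_seqs N) 'X^(weight w).

(** The factor of one visited site: two moves and a free choice of lamp. *)
Let y : {poly rat} := 'X^2 * (1 + r%:R *: 'X).

Lemma sum_center : \sum_(c <- enum F) 'X^(c != 1%g) = 1 + r%:R *: 'X :> {poly rat}.
Proof.
rewrite big_enum (bigD1 1%g) //= eqxx expr0; congr (_ + _).
rewrite (eq_bigr (fun=> 'X)) => [|c /negPf ->]; last by rewrite expr1.
rewrite sumr_const scaler_nat; congr (_ *+ _).
by have := cardC1 (1%g : F); rewrite cardF.
Qed.

(** Exactly one word of each size has no lit lamp. *)
Lemma sum_trivial N (z : {poly rat}) :
  \sum_(w <- all_seqs N) (if lit w == 0%N then z else 0) = z.
Proof.
elim: N => [|N IHN]; first by rewrite big_seq1.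
rewrite /= big_allpairs_dep (eq_bigr (fun c => if c == 1%g then z else 0)); last first.
  move=> c _; case: (eqVneq c 1%g) => [->|c1].
    by rewrite -[RHS]IHN; apply: eq_bigr => w _; rewrite lit_cons eqxx.
  by rewrite big1 // => w _; rewrite lit_cons c1.
by rewrite -big_mkcond big_enum_cond big_pred1_eq.
Qed.

(** Prepending an entry multiplies the monomial by one term of [y], except for the all-trivial word,
    which keeps weight 0 where the product would give 2; this is the correction [1 - 'X^2]. *)
Lemma side_poly_rec N : side_poly N.+1 = 1 - 'X^2 + y * side_poly N.
Proof.
rewrite /side_poly /= big_allpairs_dep /=.
have wE (c : F) (w : seq F) : 'X^(weight (c :: w)) = 'X^2 * 'X^(c != 1%g) * 'X^(weight w) +
    (if lit (c :: w) == 0%N then 1 - 'X^2 else 0) :> {poly rat}.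
  rewrite /weight extent_cons; case: ifPn => [/eqP l0|_].
    rewrite l0; move: l0; rewrite lit_cons => /eqP.
    rewrite addn_eq0 => /andP[/eqP -> /eqP lw].
    rewrite lw.
    suff -> : extent w = 0%N by rewrite muln0 !expr0 !mulr1 addrCA subrr addr0.
    by case: w lw => // d w lw; rewrite extent_cons lw.
  rewrite addr0 -!exprD; congr ('X^_).
  rewrite lit_cons.
  have exponents (a b d : nat) : (a + b + 2 * d.+1 = 2 + a + (b + 2 * d))%N by lia.
  exact: exponents.
transitivity (\sum_(c <- enum F)
    ('X^2 * 'X^(c != 1%g) * \sum_(w <- all_seqs N) 'X^(weight w) +
     \sum_(w <- all_seqs N) (if lit (c :: w) == 0%N then 1 - 'X^2 else 0)) : {poly rat}).
  apply: eq_bigr => c _; rewrite big_distrr -big_split /=.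
  by apply: eq_bigr => w _; rewrite wE.
rewrite big_split /= addrC; congr (_ + _).
  by rewrite -[RHS](sum_trivial N.+1) /= big_allpairs_dep.
by rewrite -big_distrl -big_distrr sum_center.
Qed.

(* side_poly N is the sum over one side truncated at distance N; the last term,
   of order 2N + 3, is the truncation error. *)
Lemma side_polyE N :
  (1 - y) * side_poly N = 1 - 'X^2 - r%:R *: 'X^3 * y ^+ N.
Proof.
elim: N => [|N IHN].
  rewrite /side_poly big_seq1 /weight /= muln0 expr0 mulr1 mulr1 /y -!mul_polyC.
  by ring.
by rewrite side_poly_rec mulrDr mulrCA IHN [y ^+ N.+1]exprS -!mul_polyC; ring.
Qed.

Definition triples N := [seq (c, p) | c <- enum F,
  p <- [seq (u, v) | u <- all_seqs N, v <- all_seqs N]].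

Definition triple_weight (t : F * (seq F * seq F)) : nat :=
  ((t.1 != 1%g) + (weight t.2.1 + weight t.2.2))%N.

Lemma sum_triples N : \sum_(t <- triples N) 'X^(triple_weight t) =
  (1 + r%:R *: 'X) * side_poly N ^+ 2 :> {poly rat}.
Proof.
rewrite -sum_center expr2 /side_poly big_distrlr big_distrl big_allpairs /=.
apply: eq_bigr => c _; rewrite big_allpairs big_distrr; apply: eq_bigr => u _ /=.
by rewrite big_distrr; apply: eq_bigr => v _; rewrite /= -!exprD.
Qed.

Lemma coef_sum_triples N n :
  ((1 + r%:R *: 'X) * side_poly N ^+ 2)`_n =
  (count (fun t => triple_weight t == n) (triples N))%:R.
Proof.
rewrite -sum_triples coef_sum -sum1_count natr_sum [RHS]big_mkcond /=.
by apply: eq_bigr => t _; rewrite coefXn eq_sym; case: (_ == _).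
Qed.

Lemma mem_triples N c u v :
  ((c, (u, v)) \in triples N) = (size u == N) && (size v == N).
Proof.
apply/allpairsP/andP => [[[c' p] [_ /= /allpairsP[[u' v'] [/= uN vN ->]] [_ -> ->]]]|[uN vN]].
  by rewrite -!mem_all_seqs.
exists (c, (u, v)); split=> //; first by rewrite mem_enum.
by apply/allpairsP; exists (u, v); rewrite !mem_all_seqs.
Qed.

Lemma triples_uniq N : uniq (triples N).
Proof.
apply: allpairs_uniq; first exact: enum_uniq.
  apply: allpairs_uniq; [exact: all_seqs_uniq|exact: all_seqs_uniq|].
  by move=> [? ?] [? ?] _ _ [-> ->].
by move=> [? ?] [? ?] _ _ [-> ->].
Qed.

(** An element of length n lights no lamp farther than n, so for n <= N nothing is lost by
    truncation, and the fixed size N makes the encoding injective. *)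
Lemma sphere_count_base N n : (n <= N)%N ->
  sphere_count S B n = count (fun t => triple_weight t == n) (triples N).
Proof.
move=> nN; rewrite -size_filter.
pose f (t : F * (seq F * seq F)) : lamplighter F := (cfg_of t.2.1 (t.1 :: t.2.2), 0).
have len_f t : word_length S (f t) = triple_weight t.
  by rewrite /f word_length_base /triple_weight addnA.
have fin : finite_set ([set x | word_length S x = n] `&` B).
  apply: sub_finite_set (std_ball_finite n B) => x [xn xB]; split=> //.
  by rewrite /Defs.ball /= xn.
apply/eqP; rewrite eqn_leq -(size_map f); apply/andP; split.
  apply: card_fset_set_leq => // -[eta j] [/= len_x jB].
  have j0 : j = 0 := jB; rewrite {}j0 {jB} in len_x *.
  have /word_length_leP[a [b [[sup _] le_n]]] : (word_length S (eta, 0 : int) <= n)%N.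
    by rewrite len_x.
  pose u := [seq eta (Negz k) | k <- iota 0 N].
  pose v := [seq eta (Posz k.+1) | k <- iota 0 N].
  have etaE : (eta, 0) = f (eta 0, (u, v)).
    congr pair; apply/fsfunP => i; rewrite cfg_ofE.
    have out : (N%:Z < `|i|) -> eta i = 1%g.
      move=> Ni; apply/eqP; apply: contraT => /sup; lia.
    case: i out => [[|k]|k] out //=.
      have [kN|kN] := ltnP k N; first by rewrite (nth_map 0%N) ?size_iota ?nth_iota.
      by rewrite nth_default ?size_map ?size_iota // out //; lia.
    have [kN|kN] := ltnP k N; first by rewrite (nth_map 0%N) ?size_iota ?nth_iota.
    by rewrite nth_default ?size_map ?size_iota // out //; lia.
  rewrite etaE map_f // mem_filter mem_triples !size_map !size_iota.
  by rewrite -len_f -etaE len_x !eqxx.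
apply: leq_card_fset_set => //.
  rewrite map_inj_in_uniq ?filter_uniq ?triples_uniq //.
  move=> [c [u v]] [c' [u' v']]; rewrite !mem_filter !mem_triples.
  move=> /and3P[_ /eqP su /eqP sv] /and3P[_ /eqP su' /eqP sv'] [cE].
  have [] := cfg_of_inj _ _ cE; rewrite ?su ?su' //= ?sv ?sv' //.
  by move=> -> [-> ->].
move=> _ /mapP[t + ->]; rewrite mem_filter => /andP[/eqP wt _]; split=> //=.
by rewrite len_f.
Qed.

Lemma sphere_series : series_expansion (fun n => (sphere_count S B n)%:R)
  (tofrac (1 + r%:R *: 'X) * relgrowth_P r ^+ 2).
Proof.
(* Since 1 - y + r s^3 = 1 - s^2, the series P equals (1 - s^2) / (1 - y). *)
exists ((1 + r%:R *: 'X) * (1 - 'X^2) ^+ 2), ((1 - y) ^+ 2).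
have y0 : y`_0 = 0 by rewrite /y coefXnM.
have q0 : (1 - y)`_0 = 1 by rewrite coefB y0 coef1 subr0.
have q1 : 1 - y != 0 by apply: contra_eqN q0 => /eqP ->; rewrite coef0.
split.
- by rewrite expr2 coef0M q0 mulr1.
- have d0 : tofrac (1 - y) != 0 by rewrite tofrac_eq0.
  have PE : relgrowth_P r = tofrac (1 - 'X^2) / tofrac (1 - y).
    rewrite /relgrowth_P -/y -[1 in LHS](divff d0) -mulrDl -rmorphD; congr (tofrac _ / _).
    by rewrite /y -!mul_polyC; ring.
  by rewrite PE expr_div_n !expr2 !rmorphM /= !mulrA.
move=> n; pose A : {poly rat} := (1 + r%:R *: 'X) * side_poly n ^+ 2.
(* Truncation at distance n is exact for all indices n - i in the convolution. *)
transitivity (((1 - y) ^+ 2 * A)`_n).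
  rewrite coefM; apply: eq_bigr => i _; congr (_ * _).
  by rewrite (sphere_count_base (leq_subr i n)) /A coef_sum_triples.
(* The truncation error has order 2n + 3; splitting off ['X^(n.+1)] shows that it misses the
   coefficient of index n. *)
pose h : {poly rat} := r%:R *: 'X^(n.+2) * (1 + r%:R *: 'X) ^+ n.
have zE : r%:R *: 'X^3 * y ^+ n = 'X^(n.+1) * h.
  rewrite /y /h exprMn -exprM -!scalerAl -scalerAr; congr (_ *: _).
  have shifts : 'X^3 * 'X^(2 * n) = 'X^(n.+1) * 'X^(n.+2) :> {poly rat}.
    by rewrite -!exprD; congr ('X^_); lia.
  by rewrite [LHS]mulrA [RHS]mulrA shifts.
have -> : (1 - y) ^+ 2 * A = (1 + r%:R *: 'X) * (1 - 'X^2) ^+ 2 +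
    'X^(n.+1) * ((1 + r%:R *: 'X) * h * ('X^(n.+1) * h - 2 * (1 - 'X^2))).
  have -> : (1 - y) ^+ 2 * A = (1 + r%:R *: 'X) * ((1 - y) * side_poly n) ^+ 2.
    by rewrite /A; ring.
  by rewrite side_polyE zE; ring.
by rewrite coefD coefXnM ltnSn addr0.
Qed.

End SphereSeries.

(** * Amenability and the quotient by the base group *)

Lemma bounded_funP (R : realType) (T : Type) (f : T -> R) :
  bounded_fun f <-> exists M, forall x, `|f x| <= M.
Proof.
split=> [[M [_ fM]]|[M fM]].
  by exists (M + 1) => x; apply: (fM (M + 1)) => //; rewrite ltrDl.
by exists M; split; [exact: num_real|move=> N MN x _; exact: le_trans (ltW MN)].
Qed.

Lemma ultra_fmap (T U : Type) (f : T -> U) (G : set_system T) :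
  UltraFilter G -> UltraFilter (f @ G).
Proof.
move=> GU; split; first exact: fmap_proper_filter.
move=> H HF sub; apply/seteqP; split=> [A HA|]; last exact: sub.
(* Otherwise the complement of [A] would lie in the larger filter [H] together with [A]. *)
have [//|GnA] := in_ultra_setVsetC (f @^-1` A) GU.
have /sub HnA : (f @ G) (~` A) by [].
by case: HF => + [_ HI _] => -[]; rewrite -(setICr A); exact: HI.
Qed.

(** The image ultrafilter contains the compact segment [-M, M], hence converges. *)
Lemma ultra_bounded_cvg (R : realType) (T : Type) (G : set_system T) (u : T -> R) (M : R) :
  UltraFilter G -> (forall x, `|u x| <= M) -> cvg (u @ G).
Proof.
move=> GU uM; have := @segment_compact R (- M) M; rewrite compact_ultra.
case/(_ _ (ultra_fmap u GU)) => [|l [_ ul]]; last by apply/cvg_ex; exists l.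
suff : G [set x | u x \in `[- M, M]] by [].
by apply: filterE => x; have := uM x; rewrite ler_norml /= in_itv.
Qed.

Section Cesaro.
Variable R : realType.
Implicit Types f g : int -> R.

Definition cesaro f (n : nat) : R := n.+1%:R^-1 * \sum_(i < n.+1) f i.

Lemma cesaro_bounded f M : (forall x, `|f x| <= M) -> forall n, `|cesaro f n| <= M.
Proof.
move=> fM n; rewrite /cesaro normrM ger0_norm // ler_pdivrMl ?ltr0n //.
apply: le_trans (ler_norm_sum _ _ _) _.
rewrite mulr_natl -[n.+1 in leRHS]card_ord -sumr_const; exact: ler_sum.
Qed.

Lemma cesaro_linear a f g n :
  cesaro (fun x => a * f x + g x) n = a * cesaro f n + cesaro g n.
Proof. by rewrite /cesaro big_split /= -mulr_sumr; ring. Qed.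

(** The two sums differ only in their end terms, so the difference is at most 2M / (n + 1). *)
Lemma cesaro_shift f M : (forall x, `|f x| <= M) ->
  cesaro (fun x => f (1 + x)) n - cesaro f n @[n --> \oo] --> (0 : R).
Proof.
move=> fM; have M0 : 0 <= M := le_trans (normr_ge0 _) (fM 0).
have telescope_cesaro n : cesaro (fun x => f (1 + x)) n - cesaro f n =
    harmonic n * (f n.+1 - f 0).
  rewrite /cesaro /harmonic /= -mulrBr; congr (_ * _).
  rewrite big_ord_recr [X in _ - X]big_ord_recl /=.
  have -> : \sum_(i < n) f (1 + i%:Z) = \sum_(i < n) f (lift ord0 i).
    by apply: eq_bigr => i _; congr f; rewrite lift0; lia.
  have -> : 1 + n%:Z = n.+1 by lia.
  by ring.
apply: (@squeeze_cvgr _ _ _ _ (fun n => - (harmonic n * (2 * M)))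
  (fun n => harmonic n * (2 * M))).
- near=> n; rewrite telescope_cesaro -ler_norml normrM ger0_norm ?harmonic_ge0 //.
  rewrite ler_wpM2l ?harmonic_ge0 //.
  apply: le_trans (ler_normB _ _) _; have := fM n.+1; have := fM 0; lra.
- rewrite -oppr0 -(mul0r (2 * M)); apply: cvgN; apply: cvgMl; exact: cvg_harmonic.
- rewrite -(mul0r (2 * M)); apply: cvgMl; exact: cvg_harmonic.
Unshelve. all: end_near. Qed.

(** Since [U] refines [\oo], invariance under translation by 1 follows from the vanishing difference
    of averages; induction in both directions gives every integer. *)
Lemma amenable_int : amenable R (Algebra.to_multiplicative int).
Proof.
have [U [UU sub]] := @ultraFilterLemma nat \oo _.
have UP : ProperFilter U := ultra_proper.
pose m f : R := lim (cesaro f n @[n --> U]).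
have cv f M : (forall x, `|f x| <= M) -> cvg (cesaro f n @[n --> U]).
  by move=> fM; apply: ultra_bounded_cvg (cesaro_bounded fM).
have invariant1 f M : (forall x, `|f x| <= M) -> m (fun x => f (1 + x)) = m f.
  move=> fM; apply/eqP; rewrite -subr_eq0; apply/eqP.
  have fM1 x : `|f (1 + x)| <= M by [].
  rewrite /m -(limB (cv _ _ fM1) (cv _ _ fM)).
  apply: cvg_lim => //; apply: cvg_trans (cesaro_shift fM).
  by apply: cvg_app; exact: sub.
exists m; split.
- move=> a f g /bounded_funP[M fM] /bounded_funP[N gN].
  apply: cvg_lim => //.
  rewrite (_ : cesaro _ = (fun n => a * cesaro f n + cesaro g n)); last first.
    by apply/funext => n; exact: cesaro_linear.
  by apply: cvgD; [apply: cvgMr; apply: cv fM|apply: cv gN].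
- move=> f /bounded_funP[M fM] f0; apply: limr_ge; first exact: cv fM.
  by near=> n; rewrite /cesaro mulr_ge0 // sumr_ge0.
- apply: cvg_lim => //; rewrite (_ : cesaro _ = fun=> 1); first exact: cvg_cst.
  by apply/funext => n; rewrite /cesaro sumr_const card_ord mulVf.
move=> g f /bounded_funP[M fM].
have transl (k : int) : m (fun x => f (k + x)) = m f.
  elim: k => [|k IHk|k IHk].
  - by congr m; apply/funext => x; rewrite add0r.
  - rewrite -IHk -[RHS](invariant1 _ M) //; congr m.
    by apply/funext => x; congr f; lia.
  rewrite -IHk -(invariant1 _ M) //; congr m.
  by apply/funext => x; congr f; lia.
exact: transl.
Unshelve. all: end_near. Qed.

End Cesaro.

(** * Cosets of the base group as integers *)

Section BaseCosets.
Variable F : groupType.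
Implicit Types x y g : lamplighter F.

Local Notation B := (@base_group F).

Lemma cursorV x : cursor x^-1%g = - cursor x.
Proof. by []. Qed.

Lemma base_group_normal : normal_subgroup B.
Proof.
split=> [|x y Bx By|x g Bx] //.
  change (cursor (x * y^-1)%g = 0).
  by rewrite cursorM cursorV (Bx : cursor x = 0) (By : cursor y = 0) subr0.
change (cursor (g^-1 * (x * g))%g = 0).
by rewrite !cursorM cursorV (Bx : cursor x = 0) add0r addNr.
Qed.

Lemma left_coset_base x : left_coset B x = [set y | cursor y = cursor x].
Proof.
apply/seteqP; split=> y /=.
  by move=> [h Bh <-]; rewrite cursorM (Bh : cursor h = 0) addr0.
move=> yx; exists (x^-1 * y)%g; last by rewrite mulKVg.
change (cursor (x^-1 * y)%g = 0).
by rewrite cursorM cursorV yx addNr.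
Qed.

(** Reads the cursor off an arbitrarily chosen representative; [coset_cursorE] shows that the choice
    does not matter. *)
Definition coset_cursor (A : cosets B) : int := cursor (projT1 (cid (svalP A))).

Lemma coset_cursorE x : coset_cursor (coset_proj B x) = cursor x.
Proof.
rewrite /coset_cursor; case: cid => y /= cE; apply/esym.
have : left_coset B x x by rewrite left_coset_base.
by rewrite cE left_coset_base.
Qed.

Lemma cosets_base_inj : injective coset_cursor.
Proof.
move=> [A1 [x1 E1]] [A2 [x2 E2]]; subst A1 A2; rewrite !coset_cursorE => xE.
by apply: eq_exist; rewrite !left_coset_base xE.
Qed.

Definition coset_of_cursor (j : int) : cosets B := coset_proj B (cfg_one F, j).

Lemma coset_of_cursorK : cancel coset_of_cursor coset_cursor.
Proof. by move=> j; rewrite coset_cursorE. Qed.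

Lemma coset_cursorK : cancel coset_cursor coset_of_cursor.
Proof. by move=> A; apply: cosets_base_inj; rewrite coset_of_cursorK. Qed.

Lemma base_group_quotient : quotient_isog B (Algebra.to_multiplicative int).
Proof.
exists coset_cursor; split.
  by exists coset_of_cursor; [exact: coset_cursorK|exact: coset_of_cursorK].
by move=> x y; rewrite !coset_cursorE cursorM.
Qed.

(** Identifies the action on cosets with translation on the integers, so that an invariant mean can
    be carried over. *)
Lemma translate_coset_of_cursor g (j : int) :
  translate g (coset_of_cursor j) = coset_of_cursor (cursor g + j).
Proof.
apply: eq_exist; rewrite /= !left_coset_base; apply/seteqP; split=> y /=.
  by move=> [z zj <-]; rewrite cursorM zj.
move=> yE; exists (g^-1 * y)%g; last by rewrite mulKVg.
by rewrite cursorM yE cursorV addKr.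
Qed.

Lemma base_group_coamenable (R : realType) : coamenable R B.
Proof.
have [m [mlin mpos m1 minv]] := amenable_int R.
have bounded_comp (f : cosets B -> R) : bounded_fun f -> bounded_fun (f \o coset_of_cursor).
  by move=> /bounded_funP[M fM]; apply/bounded_funP; exists M => j; exact: fM.
exists (fun f => m (f \o coset_of_cursor)); split.
- by move=> a f g bf bg; exact: mlin (bounded_comp _ bf) (bounded_comp _ bg).
- by move=> f bf f0; apply: mpos (bounded_comp _ bf) _ => j; exact: f0.
- exact: m1.
move=> g f bf; rewrite -[RHS](minv (cursor g) _ (bounded_comp _ bf)); congr m.
by apply/funext => j; rewrite /= translate_coset_of_cursor.
Qed.

End BaseCosets.

(** * Dependence on r *)

Section Asymptotics.
Variable R : realType.

Lemma omegaP r : (0 < r)%N ->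
  1 < omega R r /\ omega R r ^+ 2 = omega R r + r%:R.
Proof.
move=> r0; have r1 : 1 <= r%:R :> R by rewrite ler1n.
have : Num.sqrt (1 + 4 * r%:R) ^+ 2 = 1 + 4 * r%:R :> R by rewrite sqr_sqrtr //; lra.
have : 0 <= Num.sqrt (1 + 4 * r%:R) :> R := sqrtr_ge0 _.
by rewrite /omega; move: (Num.sqrt _) => s s0 sE; split; [nra|lra].
Qed.

(** At omega the function x^3 - x takes the value r + r omega > r, its value at rho, and it
    increases for x >= 1. *)
Lemma rho_lt_omega r : (0 < r)%N -> rho R r < omega R r.
Proof.
move=> r0; have [w1 wE] := omegaP r0; have [p1 pE _] := rhoP R r0.
have r1 : 1 <= r%:R :> R by rewrite ler1n.
rewrite ltNge; apply/negP => wp.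
have w3 : omega R r ^+ 3 = omega R r ^+ 2 + r%:R * omega R r.
  by rewrite exprS {1}wE; ring.
move: (omega R r) (rho R r) (r%:R : R) w1 wE p1 pE r1 wp w3 => w p s w1 wE p1 pE s1 wp w3.
have mono : 0 <= (p - w) * (p ^+ 2 + p * w + w ^+ 2 - 1).
  by rewrite mulr_ge0 ?subr_ge0 //; nra.
have : p ^+ 3 - p - (w ^+ 3 - w) = (p - w) * (p ^+ 2 + p * w + w ^+ 2 - 1) by ring.
nra.
Qed.

Lemma omega_sqrt_bounds r : (0 < r)%N ->
  Num.sqrt r%:R <= omega R r <= Num.sqrt r%:R + 1.
Proof.
move=> r0; have [w1 wE] := omegaP r0.
have sE : Num.sqrt r%:R ^+ 2 = r%:R :> R by rewrite sqr_sqrtr.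
have : 1 <= Num.sqrt r%:R :> R by rewrite -{1}sqrtr1 ler_wsqrtr // ler1n.
move: (Num.sqrt (r%:R : R)) sE => q sE q1; rewrite -{}sE in wE.
by apply/andP; split; nra.
Qed.

Lemma powR_inv3K r : ((r%:R : R) `^ 3^-1) ^+ 3 = r%:R.
Proof. by rewrite -powR_mulrn ?powR_ge0 // -powRrM mulVf // powRr1. Qed.

Lemma powR_inv3_ge1 r : (0 < r)%N -> 1 <= (r%:R : R) `^ 3^-1.
Proof.
by move=> r0; rewrite -[leLHS](@powRr0 _ r%:R) ler_powR ?ler1n // invr_ge0.
Qed.

(** With c^3 = r, rho^3 exceeds c^3, while x^3 - x is increasing and at c + 1 already exceeds
    c^3. *)
Lemma rho_cbrt_bounds r : (0 < r)%N ->
  r%:R `^ 3^-1 <= rho R r <= r%:R `^ 3^-1 + 1.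
Proof.
move=> r0; have [p1 pE _] := rhoP R r0.
have := powR_inv3K r; have := powR_inv3_ge1 r0.
move: (rho R r) p1 pE => p p1 pE.
move: ((r%:R : R) `^ 3^-1) => c c1 cE; rewrite -{}cE in pE.
apply/andP; split; rewrite leNgt; apply/negP => h.
  have : 0 <= (c - p) * (c ^+ 2 + c * p + p ^+ 2) by rewrite mulr_ge0 //; nra.
  have -> : (c - p) * (c ^+ 2 + c * p + p ^+ 2) = c ^+ 3 - p ^+ 3 by ring.
  by lra.
have mono : 0 < (p - (c + 1)) * (p ^+ 2 + p * (c + 1) + (c + 1) ^+ 2 - 1).
  by rewrite mulr_gt0 ?subr_gt0 //; nra.
have : p ^+ 3 - p - ((c + 1) ^+ 3 - (c + 1)) =
  (p - (c + 1)) * (p ^+ 2 + p * (c + 1) + (c + 1) ^+ 2 - 1) by ring.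
have -> : (c + 1) ^+ 3 = c ^+ 3 + 3 * c ^+ 2 + 3 * c + 1 by ring.
by nra.
Qed.

Lemma ln_bounds (x y : R) : 1 <= x -> x <= y <= x + 1 -> ln x <= ln y <= ln x + ln 2.
Proof.
move=> x1 /andP[xy yx]; have x0 : 0 < x by lra.
by rewrite -lnM ?posrE ?ler_ln ?posrE ?xy ?mulr_gt0 //=; lra.
Qed.

(** ln omega and ln rho exceed (1/2) ln r and (1/3) ln r by between 0 and ln 2, and 1/2 - 1/3 =
    1/6. *)
Lemma ln_gap_bound r : (0 < r)%N ->
  `|ln (omega R r) - ln (rho R r) - 6^-1 * ln r%:R| <= ln 2.
Proof.
move=> r0; have r0R : 0 < r%:R :> R by rewrite ltr0n.
have sq1 : 1 <= Num.sqrt r%:R :> R by rewrite -{1}sqrtr1 ler_wsqrtr // ler1n.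
have := ln_bounds sq1 (omega_sqrt_bounds r0).
have := ln_bounds (powR_inv3_ge1 r0) (rho_cbrt_bounds r0).
have -> : ln (Num.sqrt r%:R) = 2^-1 * ln r%:R :> R by rewrite -powR12_sqrt // ln_powR.
rewrite ln_powR ler_norml => /andP[a b] /andP[c d].
by apply/andP; split; lra.
Qed.

(** A bounded error is negligible against a sequence tending to infinity. *)
Lemma equiv_bounded_diff (f g : nat -> R) (K : R) :
  (forall n, (0 < n)%N -> `|f n - g n| <= K) -> g n @[n --> \oo] --> +oo ->
  f ~_\oo g.
Proof.
move=> fg /cvgryPge g_oo; apply/eqaddoP => e e0; near=> n.
have n0 : (0 < n)%N by near: n; exact: nbhs_infty_gt.
apply: le_trans (fg n n0) _; rewrite -ler_pdivrMl //.
apply: le_trans (ler_norm _); near: n; exact: g_oo.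
Unshelve. all: end_near. Qed.

Lemma sqrt_natr_cvgy : Num.sqrt n%:R @[n --> \oo] --> (+oo : set_system R).
Proof.
apply/cvgryPge => A; near=> n; apply: le_trans (ler_norm _) _.
rewrite -sqrtr_sqr ler_wsqrtr //; near: n; exact: nbhs_infty_ger.
Unshelve. all: end_near. Qed.

Lemma cbrt_natr_cvgy : n%:R `^ 3^-1 @[n --> \oo] --> (+oo : set_system R).
Proof.
apply/cvgryPge => A; near=> n; apply: le_trans (ler_norm _) _.
rewrite -(@ler_pXn2r _ 3) ?nnegrE ?powR_ge0 // powR_inv3K.
near: n; exact: nbhs_infty_ger.
Unshelve. all: end_near. Qed.

Lemma ln_natr_cvgy : 6^-1 * ln n%:R @[n --> \oo] --> (+oo : set_system R).
Proof.
apply/cvgryPge => A; near=> n; rewrite mulrC ler_pdivlMr //.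
rewrite -[leLHS]expRK ler_ln ?posrE ?expR_gt0 //.
  by near: n; exact: nbhs_infty_ger.
by rewrite ltr0n; near: n; exact: nbhs_infty_gt.
Unshelve. all: end_near. Qed.

Lemma omega_equiv : (fun r : nat => omega R r) ~_\oo (fun r : nat => Num.sqrt r%:R).
Proof.
apply: (equiv_bounded_diff (K := 1)) sqrt_natr_cvgy => r r0.
by have /andP[h1 h2] := omega_sqrt_bounds r0; rewrite ler_norml; apply/andP; split; lra.
Qed.

Lemma rho_equiv : (fun r : nat => rho R r) ~_\oo (fun r : nat => r%:R `^ 3^-1).
Proof.
apply: (equiv_bounded_diff (K := 1)) cbrt_natr_cvgy => r r0.
by have /andP[h1 h2] := rho_cbrt_bounds r0; rewrite ler_norml; apply/andP; split; lra.
Qed.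

Lemma ln_gap_equiv : (fun r : nat => ln (omega R r) - ln (rho R r)) ~_\oo
  (fun r : nat => 6^-1 * ln r%:R).
Proof. exact: equiv_bounded_diff ln_gap_bound ln_natr_cvgy. Qed.

End Asymptotics.

(** * The two growth rates and the deficiency *)

Section GrowthRates.
Variables (R : realType) (F : finGroupType) (r : nat).
Hypotheses (cardF : #|F| = r.+1) (r0 : (0 < r)%N).

Lemma growth_seq_setT : growth_seq R (@std_gens F) setT @ \oo --> omega R r.
Proof.
have [w1 wE] := omegaP R r0; have w0 : 0 < omega R r := lt_trans ltr01 w1.
(* One constant serves both sides: the upper bound needs [2 * omega R r], the lower bound only
   [omega R r]. *)
apply: (cvg_powR_inv (C := 2 * omega R r)); rewrite ?mulr_gt0 ?ltW // => n.
  have := ball_count_setT_ge cardF (ltW w1) n.+1 wE.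
  have : omega R r ^+ n <= omega R r ^+ n.+1 by rewrite ler_weXn2l // ltW.
  have : 0 <= omega R r * (ball_count (@std_gens F) setT n.+1)%:R.
    by rewrite mulr_ge0 // ltW.
  move: (omega R r ^+ n) (omega R r ^+ n.+1) => x y; lra.
exact: ball_count_setT_le cardF (ltW w1) n wE.
Qed.

Lemma growth_seq_base : growth_seq R (@std_gens F) (@base_group F) @ \oo --> rho R r.
Proof.
have [p1 pE _] := rhoP R r0; have p0 : 0 < rho R r := lt_trans ltr01 p1.
apply: (cvg_powR_inv (C := 2 * rho R r ^+ 2)); rewrite ?mulr_gt0 ?exprn_gt0 ?ltW // => n.
  have := ball_count_base_ge cardF (ltW p1) n r0 pE.
  have : 0 <= rho R r ^+ 2 * (ball_count (@std_gens F) (@base_group F) n.+1)%:R.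
    by rewrite mulr_ge0 // exprn_ge0 // ltW.
  move: (rho R r ^+ n) => x; lra.
exact: ball_count_base_le cardF (ltW p1) n pE.
Qed.

Lemma growth_deficiencyE : growth_deficiency R (@std_gens F) (@base_group F) =
  ln (omega R r) - ln (rho R r).
Proof.
rewrite /growth_deficiency /growth_rate.
by rewrite (cvg_lim _ growth_seq_setT) // (cvg_lim _ growth_seq_base).
Qed.

End GrowthRates.

Lemma growth_deficiency_unbounded (R : realType) (M : R) : exists F : finGroupType,
  (2 <= #|F|)%N /\ M < growth_deficiency R (@std_gens F) (@base_group F).
Proof.
have /cvgryPgt/(_ (M + ln 2)) big_ln := @ln_natr_cvgy R.
(* The margin ln 2 is the error in comparing the deficiency with (1/6) ln r. *)
have [r [r0 Mr]] : exists r, (0 < r)%N /\ M + ln 2 < 6^-1 * ln r%:R.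
  near \oo => r; exists r; split; near: r; [exact: nbhs_infty_gt|exact: big_ln].
(* The cyclic group of order r + 1. *)
exists 'I_r.+1; rewrite card_ord; split=> //.
rewrite (growth_deficiencyE R (card_ord r.+1) r0).
by have := ln_gap_bound R r0; rewrite ler_norml => /andP[]; lra.
Unshelve. all: end_near. Qed.

Theorem corollary1p7 (R : realType) :
  (forall (F : finGroupType) (r : nat), (1 <= r)%N -> #|F| = r.+1 ->
    let S := @std_gens F in
    let B := @base_group F in
    [/\ series_expansion (fun n => (sphere_count S B n)%:R)
          (tofrac (1 + r%:R *: 'X) * relgrowth_P r ^+ 2),
        growth_seq R S B @ \oo --> rho R r
      & rho R r < omega R r] /\
    [/\ normal_subgroup B,
        quotient_isog B (Algebra.to_multiplicative int),
        amenable R (Algebra.to_multiplicative int)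
      & coamenable R B] /\
    [/\ growth_seq R S setT @ \oo --> omega R r,
        growth_deficiency R S B = ln (omega R r) - ln (rho R r)
      & 0 < ln (omega R r) - ln (rho R r)]) /\
  [/\ (fun r : nat => omega R r) ~_\oo (fun r : nat => Num.sqrt r%:R),
      (fun r : nat => rho R r) ~_\oo (fun r : nat => r%:R `^ 3^-1),
      (fun r : nat => ln (omega R r) - ln (rho R r)) ~_\oo
        (fun r : nat => 6^-1 * ln r%:R)
    & forall M : R, exists F : finGroupType,
        (2 <= #|F|)%N /\ M < growth_deficiency R (@std_gens F) (@base_group F)].
Proof.
split=> [F r r0 cardF /=|].
  have gap : 0 < ln (omega R r) - ln (rho R r).
    have [p1 _ _] := rhoP R r0; have p_lt_w := rho_lt_omega R r0.
    by rewrite subr_gt0 ltr_ln ?posrE //; lra.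
  split; first by split; [exact: sphere_series|exact: growth_seq_base|exact: rho_lt_omega].
  split; last by split; [exact: growth_seq_setT|exact: growth_deficiencyE|].
  split; [exact: base_group_normal|exact: base_group_quotient|exact: amenable_int|].
  exact: base_group_coamenable.
split; [exact: omega_equiv|exact: rho_equiv|exact: ln_gap_equiv|].
exact: growth_deficiency_unbounded.
Qed.
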